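(* Let $P_1, \dots, P_k$ be polygons with pairwise disjoint interiors partitioning a finite region of $\mathbb{R}^2$, each $P_j$ having its own positive weight $\omega_j$, and let $p_1,\dots,p_N \in \mathbb{R}^2$. Let $C$ be the convex hull of the union of the points $p_1,\dots,p_N$ and the polygons $P_1,\dots,P_k$. Then the minimum over $q \in \mathbb{R}^2$ of $\sum_{i=1}^N w(p_i, q)$ occurs when $q$ lies in $C$ (inside it or on its boundary); that is, every minimizer lies in $C$.
   Context: Weighted distance: a path from $x$ to $y$ is decomposed into consecutive pieces $d_1,\dots,d_m$ each lying in a single region; a piece inside polygon $P_j$ has cost $\omega_j$ times its Euclidean length, and a piece lying outside all polygons (unweighted space) has cost equal to its Euclidean length. The weighted length of the path is the sum of the costs of its pieces, and $w(x,y)$ is the minimum (infimum) weighted length over all paths from $x$ to $y$. *)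

(* Defs.v *)
From HB Require Import structures.
From mathcomp Require Import all_boot all_order all_algebra.
From mathcomp Require Import all_classical all_reals all_analysis.

Set Implicit Arguments.
Unset Strict Implicit.
Unset Printing Implicit Defensive.

Import Order.TTheory GRing.Theory Num.Theory.
Import numFieldNormedType.Exports.

Local Open Scope classical_set_scope.
Local Open Scope ring_scope.

Section plane.
Context {R : realType}.
Local Notation plane := 'rV[R]_2.

(* The library norm on row vectors is the sup norm, hence this one; the two
   induce the same topology and the same bounded sets. *)
Definition norm2 (u : plane) : R := Num.sqrt (\sum_(i < 2) u 0 i ^+ 2).

Definition segment (a b : plane) : set plane :=
  [set (1 - t) *: a + t *: b | t in `[0, 1]].

Definition convex_hull (A : set plane) : set plane :=
  smallest (@convex_set R plane) A.

(* A simple polygon given by its vertices in cyclic order (ordS is the cyclic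
   successor on 'I_n): consecutive edges share exactly their common vertex, all
   other pairs of distinct edges are disjoint. *)
Record polygon := Polygon {
  nvert : nat;
  vertex : 'I_nvert -> plane;
  edge := fun i : 'I_nvert => segment (vertex i) (vertex (ordS i));
  nvert_ge3 : (3 <= nvert)%N;
  vertex_inj : injective vertex;
  edge_adj : forall i, edge i `&` edge (ordS i) = [set vertex (ordS i)];
  edge_nonadj : forall i j, i != j -> j != ordS i -> i != ordS j ->
    edge i `&` edge j = set0 }.

Definition boundary (P : polygon) : set plane := \bigcup_i edge (p := P) i.

(* The closed region: the boundary together with the points whose connected
   component in the complement of the boundary is bounded. *)
Definition region (P : polygon) : set plane :=
  boundary P `|`
  [set x | ~ boundary P x /\
           bounded_set (connected_component (~` boundary P) x)].

Definition partitions_region k (P : 'I_k -> polygon) (D : set plane) :=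
  [/\ bounded_set D, \bigcup_j region (P j) = D &
      forall i j, i != j -> (region (P i))° `&` (region (P j))° = set0].

(* Euclidean length of g on [a, b]: same as total_variation, for plane curves. *)
Definition polyline_length (a b : R) (g : R -> plane) (s : seq R) : R :=
  let G := g \o nth b (a :: s) in \sum_(0 <= n < size s) norm2 (G n.+1 - G n).

Definition curve_length (a b : R) (g : R -> plane) : \bar R :=
  ereal_sup [set (polyline_length a b g s)%:E | s in itv_partition a b].

Definition is_path (x y : plane) (g : R -> plane) :=
  [/\ {within `[0, 1], continuous g}, g 0 = x & g 1 = y].

Section weighted.
Context {k : nat} (P : 'I_k -> polygon) (omega : 'I_k -> R).

(* None stands for the unweighted space outside all polygons. *)
Definition zone (o : option 'I_k) : set plane :=
  if o is Some j then region (P j) else ~` \bigcup_j region (P j).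

Definition zone_weight (o : option 'I_k) : R :=
  if o is Some j then omega j else 1.

(* Piece number i runs over [t_i, t_(i+1)], where 0 :: s lists the t_i; it lies
   in the zone c i. Only its relative interior is constrained, since the zone
   None is not closed: a piece outside the polygons may start or end on them.
   Pieces on a common boundary may be charged to any adjacent polygon. *)
Definition decomposition (g : R -> plane) (s : seq R)
    (c : 'I_(size s) -> option 'I_k) :=
  itv_partition 0 1 s /\
  forall i : 'I_(size s),
    g @` `]nth 1 (0 :: s) i, nth 1 (0 :: s) i.+1[ `<=` zone (c i).

Definition weighted_length (g : R -> plane) (s : seq R)
    (c : 'I_(size s) -> option 'I_k) : \bar R :=
  (\sum_(i < size s) (zone_weight (c i))%:E *
     curve_length (nth 1%R (0%R :: s) i) (nth 1%R (0%R :: s) i.+1) g)%E.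

Definition wdist (x y : plane) : \bar R :=
  ereal_inf [set l | exists g s (c : 'I_(size s) -> option 'I_k),
    [/\ is_path x y g, decomposition g c & l = weighted_length g c]].

Definition sum_wdist N (p : 'I_N -> plane) (q : plane) : \bar R :=
  (\sum_(i < N) wdist (p i) q)%E.

End weighted.
End plane.

Arguments polygon : clear implicits.

(* Main.v *)
(* If q lies outside C, some unit vector u satisfies u.x <= u.q - d, d > 0, for
   every p_i and every vertex, hence on every polygon. Let T be the projection
   onto the half-plane u.x <= u.q - d/2 and v the distance to it. T fixes the
   polygons and sends the unweighted space into itself, so T o g decomposes
   exactly as g does. T is firmly nonexpansive,
     |Tx - Ty|^2 + (v y - v x)^2 <= |x - y|^2,
   so by Cauchy-Schwarz a |Tx - Ty| + b (v y - v x) <= |x - y| whenever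
   a^2 + b^2 = 1. The second term telescopes along a path, which gives
     a w(p_i, Tq) + b d/2 <= w(p_i, q).
   Summing over i and using the minimality of the sum S at q yields
   b d/2 <= (1 - a) S, which fails as b -> 0 because 1 - a = O(b^2) and S is
   finite. Finiteness holds because a straight segment crosses the edges in
   finitely many intervals, and is thus decomposable. *)
Require Import Defs.
From mathcomp Require Import all_boot all_order all_algebra.
From mathcomp Require Import all_classical all_reals all_analysis.
From mathcomp Require Import ring lra.
Import Order.TTheory GRing.Theory Num.Theory.
Import numFieldNormedType.Exports.
Local Open Scope classical_set_scope.
Local Open Scope ring_scope.

(** * The Euclidean inner product of the plane *)

Definition dot {R : realType} (u x : 'rV[R]_2) : R := \sum_(i < 2) u 0 i * x 0 i.

Section dot.
Context {R : realType}.
Implicit Types (u x y : 'rV[R]_2) (a : R).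

Lemma dotC u x : dot u x = dot x u.
Proof. by apply: eq_bigr => i _; rewrite mulrC. Qed.

Lemma dotDr u x y : dot u (x + y) = dot u x + dot u y.
Proof. by rewrite /dot -big_split; apply: eq_bigr => i _; rewrite mxE mulrDr. Qed.

Lemma dotZr u a x : dot u (a *: x) = a * dot u x.
Proof. by rewrite /dot mulr_sumr; apply: eq_bigr => i _; rewrite mxE mulrCA. Qed.

Lemma dotNr u x : dot u (- x) = - dot u x.
Proof. by rewrite -scaleN1r dotZr mulN1r. Qed.

Lemma dotBr u x y : dot u (x - y) = dot u x - dot u y.
Proof. by rewrite dotDr dotNr. Qed.

Lemma dotBl u x y : dot (x - y) u = dot x u - dot y u.
Proof. by rewrite dotC dotBr !(dotC u). Qed.

Lemma dotDl u x y : dot (x + y) u = dot x u + dot y u.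
Proof. by rewrite dotC dotDr !(dotC u). Qed.

Lemma dotZl u a x : dot (a *: x) u = a * dot x u.
Proof. by rewrite dotC dotZr dotC. Qed.

Lemma dot_ge0 x : 0 <= dot x x.
Proof. by apply: sumr_ge0 => i _; rewrite -expr2 sqr_ge0. Qed.

Lemma dot_eq0 x : (dot x x == 0) = (x == 0).
Proof.
apply/idP/eqP => [|->]; last by rewrite /dot big1// => i _; rewrite mxE mul0r.
rewrite psumr_eq0; last by move=> i _; rewrite -expr2 sqr_ge0.
move=> /allP x0; apply/rowP => i; rewrite mxE; apply/eqP.
by have := x0 i (mem_index_enum i); rewrite mulf_eq0 orbb.
Qed.

Lemma dot_gt0 x : x != 0 -> 0 < dot x x.
Proof. by move=> x0; rewrite lt_neqAle dot_ge0 andbT eq_sym dot_eq0. Qed.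

Lemma continuous_dot u : continuous (dot u).
Proof.
apply: continuous_big; first exact: add_continuous.
move=> i _ x; apply: continuousM; first exact: cst_continuous.
exact: coord_continuous.
Qed.

Lemma norm2E x : norm2 x = Num.sqrt (dot x x).
Proof. by congr Num.sqrt; apply: eq_bigr => i _; rewrite expr2. Qed.

Lemma norm2_ge0 x : 0 <= norm2 x. Proof. exact: sqrtr_ge0. Qed.

Lemma norm2Z a x : norm2 (a *: x) = `|a| * norm2 x.
Proof.
by rewrite !norm2E dotZr dotZl mulrA -expr2 sqrtrM ?sqr_ge0// sqrtr_sqr.
Qed.

End dot.

(** * Strict separation of a point from the hull of finitely many points *)

Section separation.
Context {R : realType}.

Lemma convex_set_conv (A : set 'rV[R]_2) x y t : convex_set A ->
  A x -> A y -> 0 <= t -> t <= 1 -> A (t *: x + (1 - t) *: y).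
Proof.
move=> cA Ax Ay t0 t1.
have := cA x y (Itv01 t0 t1); rewrite !inE; exact.
Qed.

(** Induction splitting off the last point: the other weights are renormalised by their total [S].
    If [S = 0] they all vanish and only the last point remains. *)
Lemma convex_set_sum (A : set 'rV[R]_2) n (F : 'I_n -> 'rV[R]_2) l :
  convex_set A -> (forall i, A (F i)) ->
  (forall i, 0 <= l i) -> \sum_i l i = 1 -> A (\sum_i l i *: F i).
Proof.
move=> cA; elim: n => [|n IH] in F l *.
  by move=> _ _; rewrite big_ord0 => /eqP; rewrite eq_sym oner_eq0.
move=> AF l0; rewrite !big_ord_recr/= => l1.
set S := \sum_(i < n) l _ in l1; set a := l ord_max in l1 *.
have S0 : 0 <= S by apply: sumr_ge0 => i _; exact: l0.
have a0 : 0 <= a by exact: l0.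
have [S_eq0|S_neq0] := eqVneq S 0.
  rewrite big1 => [|i _].
    by move: l1; rewrite S_eq0 !add0r => ->; rewrite scale1r.
  have/eqP := S_eq0; rewrite psumr_eq0; last by move=> j _; exact: l0.
  by move=> /allP/(_ i (mem_index_enum i))/eqP->; rewrite scale0r.
pose l' i := l (widen_ord (leqnSn n) i) / S.
have AS : A (\sum_i l' i *: F (widen_ord (leqnSn n) i)).
  apply: IH => // [i|]; first by rewrite divr_ge0.
  by rewrite -mulr_suml divff.
have -> : \sum_(i < n) l (widen_ord (leqnSn n) i) *: F (widen_ord (leqnSn n) i) =
    S *: (\sum_i l' i *: F (widen_ord (leqnSn n) i)).
  rewrite scaler_sumr; apply: eq_bigr => i _.
  by rewrite scalerA /l' mulrCA divff// mulr1.
have -> : a = 1 - S by rewrite -l1 addrAC subrr add0r.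
by apply: convex_set_conv => //; rewrite -l1 lerDl.
Qed.

(** The simplex is a closed subset of the compact cube of vectors with entries in [0, 1]. *)
Lemma compact_simplex n :
  compact [set l : 'rV[R]_n | (forall i, 0 <= l 0 i) /\ \sum_i l 0 i = 1].
Proof.
rewrite (_ : mkset _ = [set l : 'rV[R]_n | forall i, `[0, 1]%classic (l ord0 i)] `&`
    (fun l : 'rV[R]_n => \sum_i l 0 i) @^-1` [set 1]).
  apply: compact_closedI.
    by apply: (@rV_compact R n (fun=> `[0, 1]%classic)) => _; exact: segment_compact.
  apply: closed_comp; last exact: closed_eq.
  move=> l _; move: l; by apply: continuous_big => [|i _]; [exact: add_continuous|exact: coord_continuous].
apply/seteqP; split=> l /= [l0 l1]; split=> // i.
  by rewrite in_itv/= l0/= -l1 (bigD1 i)//= lerDl sumr_ge0.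
by have := l0 i; rewrite in_itv/= => /andP[].
Qed.

(** Compactness of the weight simplex provides a convex combination of the [F i] nearest to [q]; the
    separating direction runs from that point to [q]. *)
Lemma finite_strict_separation n (F : 'I_n.+1 -> 'rV[R]_2) (q : 'rV[R]_2) :
  ~ convex_hull (range F) q ->
  exists u d, [/\ dot u u = 1, 0 < d & forall i, dot u (F i) <= dot u q - d].
Proof.
move=> nq.
pose z (l : 'rV[R]_n.+1) : 'rV[R]_2 := \sum_i l 0 i *: F i - q.
pose D := [set l : 'rV[R]_n.+1 | (forall i, 0 <= l 0 i) /\ \sum_i l 0 i = 1].
pose f l := dot (z l) (z l).
have De i : D (delta_mx 0 i).
  split=> [j|]; first by rewrite mxE ler0n.
  rewrite (bigD1 i)//= mxE !eqxx big1 ?addr0// => j ji.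
  by rewrite mxE (negPf ji) andbF.
have cz j : continuous (fun l => z l 0 j).
  have -> : (fun l => z l 0 j) =
      (fun l : 'rV[R]_n.+1 => \sum_i l 0 i * F i 0 j - q 0 j).
    apply/funext => l; rewrite !mxE summxE; congr (_ - _).
    by apply: eq_bigr => i _; rewrite mxE.
  move=> l; apply: continuousB; last exact: cst_continuous.
  apply: continuous_big => [|i _]; first exact: add_continuous.
  move=> {}l; apply: continuousM; first exact: coord_continuous.
  exact: cst_continuous.
have cf : continuous f.
  apply: continuous_big => [|j _]; first exact: add_continuous.
  by move=> l; apply: continuousM; exact: cz.
have [||l + lmin] := EVT_min_rV (f := f) _ (@compact_simplex n.+1).
- by exists (delta_mx 0 0); exact: De.
- exact: continuous_subspaceT.
rewrite inE => -[l0 l1].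
have z_neq0 : z l != 0.
  apply/negP; rewrite subr_eq0 => /eqP zq; apply: nq => A [cA FA].
  by rewrite -zq; apply: convex_set_sum => // i; apply: FA; exists i.
have zz := dot_gt0 _ z_neq0.
(* First-order optimality of [z l] along the segment towards [F i]. *)
have var i : dot (z l) (z l) <= dot (z l) (F i - q).
  set v := F i - q; have [//|lt] := leP (dot (z l) (z l)) (dot (z l) v).
  pose w := v - z l; have ww := dot_ge0 w.
  pose a := dot (z l) (z l) - dot (z l) v; have a0 : 0 < a by rewrite subr_gt0.
  (* Moving by [t] towards [F i] lowers the squared distance by [t * (2 * a - t * dot w w)], which
     is at least [t * a > 0] for such a [t]: the minimality of [l] is contradicted. *)
  have [t [t0 t1 tw]] : exists t, [/\ 0 < t, t <= 1 & t * dot w w <= a].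
    have aw : 0 < a + dot w w by rewrite ltr_wpDr.
    exists (a / (a + dot w w)); rewrite divr_gt0// ler_pdivrMr// mul1r lerDl ww.
    by rewrite mulrAC ler_pdivrMr// ler_pM2l// lerDr ltW.
  have Dt : D ((1 - t) *: l + t *: delta_mx 0 i).
    have [e0 e1] := De i; split=> [j|].
      rewrite mxE [X in X + _]mxE [X in _ + X]mxE.
      by apply: addr_ge0; apply: mulr_ge0 => //; [rewrite subr_ge0|exact: ltW].
    under eq_bigr do rewrite mxE [X in X + _]mxE [X in _ + X]mxE.
    by rewrite big_split/= -!mulr_sumr l1 e1; ring.
  have zt : z ((1 - t) *: l + t *: delta_mx 0 i) = z l + t *: w.
    rewrite /z /w /v (_ : \sum_i _ = (1 - t) *: (\sum_i l 0 i *: F i) + t *: F i).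
      by apply/rowP => j; rewrite !mxE; ring.
    under eq_bigr do rewrite mxE [X in X + _]mxE [X in _ + X]mxE scalerDl -!scalerA.
    rewrite big_split/= -!scaler_sumr [X in _ + _ *: X](_ : _ = F i)//.
    rewrite (bigD1 i)//= mxE !eqxx scale1r big1 ?addr0// => j ji.
    by rewrite mxE (negPf ji) andbF scale0r.
  have := lmin ((1 - t) *: l + t *: delta_mx 0 i).
  rewrite inE => /(_ Dt); rewrite /f zt.
  have -> : dot (z l + t *: w) (z l + t *: w) =
      dot (z l) (z l) - t * (2 * a - t * dot w w).
    have wz : dot w (z l) = - a by rewrite dotBl (dotC v) opprB.
    by rewrite dotDr 2!dotDl !dotZr !dotZl (dotC (z l) w) wz; ring.
  rewrite lerBrDr gerDl pmulr_rle0// => H.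
  by move: H a0 tw; lra.
pose e := norm2 (z l).
have ee : e * e = dot (z l) (z l) by rewrite -expr2 /e norm2E sqr_sqrtr// dot_ge0.
have e0 : 0 < e by rewrite /e norm2E sqrtr_gt0.
(* The gap is the distance [e] itself: dividing [var] by [- e] gives [dot u (F i - q) <= - e]. *)
exists (- e^-1 *: z l), e; split=> // [|i].
  by rewrite dotZr dotZl -ee mulrA mulrNN -!mulrA; field; rewrite gt_eqF.
have := var i; rewrite dotBr !dotZl !mulNr -opprD lerN2 -ee => H.
rewrite -(ler_pM2l e0) mulrDr !mulrA divff ?gt_eqF// !mul1r; lra.
Qed.

End separation.

(** * Half-planes containing the vertices of a polygon *)

Section halfplane.
Context {R : realType}.
Implicit Types (u x y : 'rV[R]_2).

Lemma segment_halfplane u m a b x : dot u a <= m -> dot u b <= m ->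
  segment a b x -> dot u x <= m.
Proof.
move=> am bm [t /=]; rewrite in_itv/= => /andP[t0 t1] <-.
rewrite dotDr !dotZr -[leRHS]mul1r -[X in X * m](subrK t) [leRHS]mulrDl.
by rewrite lerD// ler_wpM2l// subr_ge0.
Qed.

Lemma le_coord_norm y i : `|y 0 i| <= `|y|.
Proof.
by rewrite [leRHS]/Num.norm/= mx_normrE; apply/bigmax_geP; right; exists (0, i).
Qed.

Lemma continuous_line (x y : 'rV[R]_2) : continuous (fun t : R => x + t *: y).
Proof.
move=> t; apply: cvgD; first exact: cst_continuous.
by apply: cvgZr_tmp; exact: cvg_id.
Qed.

(* A point beyond the vertices escapes to infinity along the ray of direction
   [u] without meeting the boundary. *)
Lemma region_halfplane (P : polygon R) u m x : dot u u != 0 ->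
  (forall i, dot u (vertex (p := P) i) <= m) -> region P x -> dot u x <= m.
Proof.
move=> u0 Pm; have bm y : boundary P y -> dot u y <= m.
  by move=> [i _]; exact: segment_halfplane.
case=> [/bm//|[_ bx]]; rewrite leNgt; apply/negP => mx.
have [i ui] : exists i, u 0 i != 0.
  apply/existsP; rewrite -negb_forall; apply: contra u0 => /forallP z.
  by rewrite /dot big1// => j _; rewrite (eqP (z j)) mul0r.
pose ray t := x + t *: u.
have cray : continuous ray by exact: continuous_line.
pose A := ray @` `[0, +oo[.
have Acc : A `<=` connected_component (~` boundary P) x.
  apply: connected_component_max.
  - by exists 0; rewrite /ray ?scale0r ?addr0//= in_itv/= lexx.
  - move=> _ [t + <-] /bm; rewrite /= in_itv/= andbT => t0; apply/negP.
    rewrite -ltNge dotDr dotZr (lt_le_trans mx)// lerDl mulr_ge0//.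
    exact: dot_ge0.
  - apply: connected_continuous_connected; last exact: continuous_subspaceT.
    exact/connected_intervalP/interval_is_interval.
have [M [Mr /(_ (M + 1))]] := bx; rewrite ltrDl ltr01 => /(_ isT) bM.
(* Chosen so that coordinate [i] of [t *: u] has size [|M| + 2 + |x_i|]; coordinate [i] of [ray t]
   then exceeds the bound [M + 1] in absolute value. *)
pose t := (`|M| + 2 + `|x 0 i|) / `|u 0 i|.
have At : A (ray t) by exists t => //=; rewrite in_itv/= andbT divr_ge0// !addr_ge0.
have := le_trans (le_coord_norm (ray t) i) (bM _ (Acc _ At)).
rewrite mxE [(t *: u) _ _]mxE => H.
have tu : `|t * u 0 i| = `|M| + 2 + `|x 0 i|.
  by rewrite normrM ger0_norm ?divr_ge0 ?addr_ge0// divfK ?normr_eq0.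
have := ler_normB (x 0 i + t * u 0 i) (x 0 i).
rewrite addrAC subrr add0r tu; move: (ler_norm M) H; lra.
Qed.

End halfplane.

(** * Projection onto a half-plane *)

Section truncation.
Context {R : realType} (u : 'rV[R]_2) (m : R).
Hypothesis u1 : dot u u = 1.
Implicit Types x y : 'rV[R]_2.

(** As [u] is a unit vector, this is the distance [v] to the half-plane [dot u x <= m], and
    [truncate] is the nearest-point projection [T]. *)
Definition overshoot x : R := Num.max 0 (dot u x - m).

Definition truncate x : 'rV[R]_2 := x - overshoot x *: u.

Lemma overshoot_le x : dot u x <= m -> overshoot x = 0.
Proof. by move=> xm; rewrite /overshoot max_l// subr_le0. Qed.

Lemma overshoot_gt x : m < dot u x -> overshoot x = dot u x - m.
Proof. by move=> xm; rewrite /overshoot max_r// subr_ge0 ltW. Qed.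

Lemma truncate_id x : dot u x <= m -> truncate x = x.
Proof. by move=> xm; rewrite /truncate overshoot_le// scale0r subr0. Qed.

Lemma dot_truncate x : m < dot u x -> dot u (truncate x) = m.
Proof.
by move=> xm; rewrite dotBr dotZr u1 mulr1 overshoot_gt// opprB addrC subrK.
Qed.

Lemma continuous_truncate : continuous truncate.
Proof.
move=> x; apply: (@cvgB _ _ _ (nbhs x) _ id (fun y => overshoot y *: u)).
  exact: cvg_id.
apply: cvgZr_tmp; apply: (@continuous_max _ _ (cst 0) (fun x => dot u x - m)).
  exact: cst_continuous.
apply: (@continuousB _ _ _ (dot u) (cst m)); first exact: continuous_dot.
exact: cst_continuous.
Qed.

(** The overshoot is a nondecreasing 1-Lipschitz function of [dot u x], so its increment [e]
    satisfies [e * e <= e * dot u (y - x)]. The claim follows by expanding the square of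
    [(y - x) - e *: u]. *)
Lemma truncate_firm x y :
  dot (truncate y - truncate x) (truncate y - truncate x) +
    (overshoot y - overshoot x) ^+ 2 <= dot (y - x) (y - x).
Proof.
set e := overshoot y - overshoot x.
have -> : truncate y - truncate x = (y - x) - e *: u.
  by apply/rowP => i; rewrite !mxE /e; ring.
have He : e * e <= e * dot u (y - x).
  rewrite dotBr /e; have [xm|xm] := leP (dot u x) m; have [ym|ym] := leP (dot u y) m.
  - by rewrite !overshoot_le// subrr !mul0r.
  - rewrite (overshoot_le _ xm) overshoot_gt// subr0 ler_wpM2l//; lra.
  - rewrite (overshoot_le _ ym) overshoot_gt// sub0r ler_wnM2l//; lra.
  - by rewrite !overshoot_gt//; nra.
move: (y - x) He => d; rewrite dotBr !dotBl !dotZr !dotZl u1 (dotC d u) expr2; lra.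
Qed.

(** Cauchy-Schwarz for the pairs [(c, s)] and [(n, e)], through the Lagrange identity with remainder
    [(s * n - c * e) ^+ 2]. *)
Lemma truncate_contract c s x y : c ^+ 2 + s ^+ 2 = 1 ->
  c * norm2 (truncate y - truncate x) + s * (overshoot y - overshoot x) <=
    norm2 (y - x).
Proof.
move=> cs; have := truncate_firm x y.
set d := truncate y - truncate x; set e := overshoot y - overshoot x => H.
apply: le_trans (ler_norm _) _; rewrite -sqrtr_sqr [leRHS]norm2E.
apply: ler_wsqrtr; apply: le_trans H.
have -> : dot d d = norm2 d ^+ 2 by rewrite norm2E sqr_sqrtr// dot_ge0.
move: (norm2 d) => n.
have -> : n ^+ 2 + e ^+ 2 = (c * n + s * e) ^+ 2 + (s * n - c * e) ^+ 2.
  by rewrite -[LHS]mul1r -cs; ring.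
by rewrite lerDl sqr_ge0.
Qed.

End truncation.

(** * Lengths of curves *)

Section length.
Context {R : realType}.

Lemma polyline_length_ge0 (a b : R) g s : 0 <= polyline_length a b g s.
Proof. by apply: sumr_ge0 => n _; exact: norm2_ge0. Qed.

Lemma curve_length_ge0 (a b : R) g : a < b -> (0 <= curve_length a b g)%E.
Proof.
move=> ab; apply: (@le_trans _ _ (polyline_length a b g [:: b])%:E).
  by rewrite lee_fin polyline_length_ge0.
by apply: ereal_sup_ubound; exists [:: b] => //; exact: itv_partition1.
Qed.

Lemma telescope_itv_partition (a b : R) s (f : R -> R) : itv_partition a b s ->
  \sum_(0 <= n < size s) (f (nth b (a :: s) n.+1) - f (nth b (a :: s) n)) =
  f b - f a.
Proof.
move=> abs; rewrite (telescope_sumr (fun n => f (nth b (a :: s) n)))//.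
by rewrite (itv_partition_nth_size _ abs).
Qed.

(** [truncate_contract] on each chord of a subdivision: the overshoot increments telescope to a
    quantity independent of the subdivision, so the supremum can be taken; [0 < c] lets [c] be moved
    across it. *)
Lemma curve_length_truncate u (m c s a b : R) g : dot u u = 1 ->
  c ^+ 2 + s ^+ 2 = 1 -> 0 < c ->
  (c%:E * curve_length a b (truncate u m \o g) +
     (s * (overshoot u m (g b) - overshoot u m (g a)))%:E <= curve_length a b g)%E.
Proof.
move=> u1 cs c0; rewrite -leeBrDr// -lee_pdivlMl//.
apply: ge_ereal_sup => _ [l abl <-]; rewrite lee_pdivlMl// leeBrDr//.
apply: (@le_trans _ _ (polyline_length a b g l)%:E); last first.
  by apply: ereal_sup_ubound; exists l.
rewrite -EFinM -EFinD lee_fin /polyline_length/=.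
rewrite -(telescope_itv_partition _ _ _ (overshoot u m \o g) abl) !mulr_sumr -big_split/=.
by apply: ler_sum => n _; exact: truncate_contract.
Qed.

Lemma curve_length_line (a b : R) (x y : 'rV[R]_2) : a < b ->
  (curve_length a b (fun t => x + t *: y)%R < +oo)%E.
Proof.
move=> ab; apply: (@le_lt_trans _ _ ((b - a) * norm2 y)%:E); last exact: ltry.
apply: ge_ereal_sup => _ [l abl <-]; rewrite lee_fin.
have [/= pl _] := abl.
rewrite -(telescope_itv_partition _ _ _ id abl) mulr_suml /polyline_length big_nat.
rewrite [leRHS]big_nat; apply: ler_sum => n /= nl.
rewrite (_ : _ - _ = (nth b l n - nth b (a :: l) n) *: y); last first.
  by apply/rowP => i; rewrite !mxE; ring.
rewrite norm2Z ger0_norm// subr_ge0 ltW//.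
by have /(pathP b) := pl; apply.
Qed.

(** Passes to one-sided limits at the endpoints, because a decomposition constrains only the
    relative interior of each piece. *)
Lemma le_closed_itv (f : R -> R) (a b m : R) : a < b ->
  {within `[a, b], continuous f} -> (forall t, a < t < b -> f t <= m) ->
  f a <= m /\ f b <= m.
Proof.
move=> ab /(continuous_within_itvP _ ab)[_ fa fb] fm; split.
- apply: (@closed_cvg _ _ (a^'+) _ f [set t | t <= m] _ _ _ fa); first exact: closed_le.
  near=> t; apply: fm.
  by apply/andP; split; near: t; [exact: nbhs_right_gt|exact: nbhs_right_lt].
- apply: (@closed_cvg _ _ (b^'-) _ f [set t | t <= m] _ _ _ fb); first exact: closed_le.
  near=> t; apply: fm.
  by apply/andP; split; near: t; [exact: nbhs_left_gt|exact: nbhs_left_lt].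
Unshelve. all: by end_near.
Qed.

End length.

(** * Effect of the projection on the weighted distance *)

Section wdist.
Context {R : realType} {k : nat} (P : 'I_k -> polygon R) (omega : 'I_k -> R).
Hypothesis omega_gt0 : forall j, 0 < omega j.

Lemma zone_weight_gt0 o : 0 < zone_weight omega o.
Proof. by case: o => /=. Qed.

Lemma decomposition_lt g s (c : 'I_(size s) -> option 'I_k) (i : 'I_(size s)) :
  decomposition P g c -> nth 1 (0 :: s) i < nth 1 (0 :: s) i.+1.
Proof. by move=> [[/(pathP 1) s01 _] _]; exact: s01. Qed.

Lemma weighted_length_ge0 g s (c : 'I_(size s) -> option 'I_k) :
  decomposition P g c -> (0 <= weighted_length omega g c)%E.
Proof.
move=> dc; apply: sume_ge0 => i _; rewrite mule_ge0 ?lee_fin ?(ltW (zone_weight_gt0 _))//.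
by apply: curve_length_ge0; exact: (decomposition_lt _ _ _ i dc).
Qed.

Lemma wdist_ge0 x y : (0 <= wdist P omega x y)%E.
Proof.
apply: le_ereal_inf_tmp => _ [g [s [c [_ dc ->]]]].
exact: weighted_length_ge0.
Qed.

Section truncate.
Context (u : 'rV[R]_2) (m m' : R).
Hypotheses (u1 : dot u u = 1) (mm' : m < m').
Hypothesis Pm : forall j x, region (P j) x -> dot u x <= m.

(** Points of polygons are fixed. A point that moves lands on the line [dot u x = m'], strictly
    beyond every polygon because [m < m'], so it stays in the unweighted zone. *)
Lemma decomposition_truncate g s (c : 'I_(size s) -> option 'I_k) :
  decomposition P g c -> decomposition P (truncate u m' \o g) c.
Proof.
move=> [s01 gc]; split=> // i _ [t it <-] /=.
have := gc i (g t) (ex_intro2 _ _ t it erefl).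
move: (g t) (c i) => x [j|] /= xz.
  by rewrite truncate_id// (le_trans (Pm _ _ xz))// ltW.
have [xm|xm] := leP (dot u x) m'; first by rewrite truncate_id.
by move=> [j _ /Pm]; rewrite dot_truncate// leNgt mm'.
Qed.

Lemma is_path_truncate x y g :
  is_path x y g -> is_path (truncate u m' x) (truncate u m' y) (truncate u m' \o g).
Proof.
move=> [cg g0 g1]; split; rewrite /= ?g0 ?g1//.
apply: within_continuous_comp cg => x' _; exact: continuous_truncate.
Qed.

Lemma wdist_truncate x y (a b : R) : a ^+ 2 + b ^+ 2 = 1 -> 0 < a ->
  dot u x <= m' ->
  (a%:E * wdist P omega x (truncate u m' y) + (b * overshoot u m' y)%:E <=
   wdist P omega x y)%E.
Proof.
move=> ab a0 xm; apply: le_ereal_inf_tmp => _ [g [s [c [gp dc ->]]]].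
have dTc := decomposition_truncate _ _ _ dc.
apply: (@le_trans _ _ (a%:E * weighted_length omega (truncate u m' \o g) c +
    (b * overshoot u m' y)%:E)%E).
  rewrite leeD2r// lee_pmul2l// ereal_inf_lbound//.
  exists (truncate u m' \o g), s, c; split=> //.
  by have := is_path_truncate _ _ _ gp; rewrite (truncate_id _ _ _ xm).
have [cg g0 g1] := gp; have [s01 gc] := dc.
(* The total overshoot is spread over the pieces; it telescopes, and the contribution of the start
   [x] is zero. *)
have <- : (\sum_(i < size s) (b * (overshoot u m' (g (nth 1 (0 :: s) i.+1)) -
    overshoot u m' (g (nth 1 (0 :: s) i)))))%:E = (b * overshoot u m' y)%:E.
  congr EFin; rewrite -mulr_sumr.
  rewrite -(big_mkord xpredT (fun i => overshoot u m' (g (nth 1 (0 :: s) i.+1)) -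
    overshoot u m' (g (nth 1 (0 :: s) i)))).
  rewrite (telescope_itv_partition _ _ _ (overshoot u m' \o g) s01)/= g0 g1.
  by rewrite (overshoot_le _ _ _ xm) subr0.
rewrite -sumEFin /weighted_length ge0_sume_distrr; last first.
  move=> i _; rewrite mule_ge0 ?lee_fin ?(ltW (zone_weight_gt0 _))//.
  by apply: curve_length_ge0; exact: (decomposition_lt _ _ _ i dc).
rewrite -big_split/=; apply: lee_sum => i _.
have lti := decomposition_lt _ _ _ i dc.
set t0 := nth 1 (0 :: s) i in lti *; set t1 := nth 1 (0 :: s) i.+1 in lti *.
have w0 := zone_weight_gt0 (c i).
have H := curve_length_truncate u m' a b t0 t1 g u1 ab a0.
(* The weight may be inserted freely: outside the polygons it is 1, and on a piece inside a polygon
   both endpoints have zero overshoot. *)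
have -> : b * (overshoot u m' (g t1) - overshoot u m' (g t0)) =
    zone_weight omega (c i) * (b * (overshoot u m' (g t1) - overshoot u m' (g t0))).
  have := gc i; case: (c i) => [j|] /= gz; last by rewrite mul1r.
  have t0_ge0 : 0 <= t0 by apply: itv_partition_nth_ge s01; rewrite ltnW ?ltnS.
  have t1_le1 : t1 <= 1 by apply: itv_partition_nth_le s01; rewrite ltnS.
  have ct : {within `[t0, t1], continuous (fun t => dot u (g t))}.
    apply: (@within_continuous_comp _ _ _ _ g (dot u)) => [x' _|].
      exact: continuous_dot.
    apply: continuous_subspaceW cg => t /=; rewrite !in_itv/= => /andP[tt0 tt1].
    by rewrite (le_trans t0_ge0)// (le_trans tt1).
  have [|gt0 gt1] := le_closed_itv _ t0 t1 m lti ct.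
    by move=> t tt; apply: (Pm j); apply: gz; exists t; rewrite //= in_itv/= tt.
  by rewrite !overshoot_le ?(le_trans _ (ltW mm'))// subrr !mulr0.
rewrite muleCA (EFinM (zone_weight _ _)) -muleDr ?fin_num_adde_defl//.
by rewrite lee_pmul2l// lte_fin.
Qed.

End truncate.

End wdist.

(** * Finiteness of the weighted distance along straight segments *)

Section segment_path.
Context {R : realType}.

Lemma gap_partition (B : seq R) : exists s : seq R, itv_partition 0 1 s /\
  forall i, (i < size s)%N -> forall z, z \in B ->
    ~ nth 1 (0 :: s) i < z < nth 1 (0 :: s) i.+1.
Proof.
pose s0 := sort <=%R (undup [seq z <- B | 0 < z < 1]).
have s0E z : (z \in s0) = (0 < z < 1) && (z \in B).
  by rewrite mem_sort mem_undup mem_filter.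
have srt : sorted <%R (0 :: rcons s0 1).
  rewrite /= rcons_path path_min_sorted; last first.
    by apply/allP => z; rewrite s0E => /andP[/andP[]].
  rewrite sort_lt_sorted undup_uniq /=.
  have := mem_last 0 s0; rewrite inE => /predU1P[->//|].
  by rewrite s0E => /andP[/andP[]].
exists (rcons s0 1); split=> [|i si z zB /andP[iz zi]].
  by split=> //; rewrite last_rcons.
have zs : z \in 0 :: rcons s0 1.
  rewrite inE mem_rcons inE s0E zB andbT.
  have iz0 : 0 <= nth 1 (0 :: rcons s0 1) i.
    by apply: (@itv_partition_nth_ge _ _ 0 1); [rewrite ltnS ltnW|split; rewrite ?last_rcons].
  have zi1 : nth 1 (0 :: rcons s0 1) i.+1 <= 1.
    by apply: (@itv_partition_nth_le _ _ 0 1); [rewrite ltnS|split; rewrite ?last_rcons].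
  by rewrite (le_lt_trans iz0)//= (lt_le_trans zi)// !orbT.
move: iz zi; rewrite -(nth_index 1 zs) !(lt_sorted_ltn_nth 1 srt) ?inE ?index_mem//.
- by rewrite ltnS => i1 i2; move: (leq_trans i1 i2); rewrite ltnn.
- by rewrite /= ltnS ltnW.
Qed.

(** If [I] held at [t] but not at [t'], then [t'] would bound [I] on one side, placing [sup I] or
    [inf I] between the two points. *)
Lemma interval_gap (I : set R) (a b : R) : is_interval I ->
  ~ a < inf I < b -> ~ a < sup I < b ->
  forall t t', a < t < b -> a < t' < b -> I t -> I t'.
Proof.
move=> itvI ninf nsup t t' /andP[at_ tb] /andP[at' t'b] It.
apply: contrapT => It'.
have [tt'|t't|tt'] := ltgtP t t'; last by apply: It'; rewrite -tt'.
- have ub : ubound I t'.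
    move=> r Ir; rewrite leNgt; apply/negP => t'r; apply: It'.
    by apply: (itvI t r) => //; rewrite !ltW.
  apply: nsup; rewrite (lt_le_trans at_)/=; last by apply: ub_le_sup => //; exists t'.
  by rewrite (le_lt_trans _ t'b)//; apply: ge_sup => //; exists t.
- have lb : lbound I t'.
    move=> r Ir; rewrite leNgt; apply/negP => rt'; apply: It'.
    by apply: (itvI r t) => //; rewrite !ltW.
  apply: ninf; rewrite (lt_le_trans at')/=; last by apply: lb_le_inf => //; exists t.
  by rewrite (le_lt_trans _ tb)//; apply: ge_inf => //; exists t'.
Qed.

(** Preimage of a convex set under an affine map; the parameters [r1] and [r2] on the segment are
    interpolated with the same ratio [l]. *)
Lemma segment_interval (a b x y : 'rV[R]_2) :
  is_interval [set t | segment a b (x + t *: y)].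
Proof.
move=> t1 t2 [r1 /=]; rewrite in_itv/= => /andP[r10 r11] e1.
move=> [r2 /=]; rewrite in_itv/= => /andP[r20 r21] e2 t /andP[t1t tt2].
have [e|ne] := eqVneq t1 t2.
  have -> : t = t1 by apply/le_anti; rewrite t1t e tt2.
  by exists r1 => //; rewrite /= in_itv/= r10 r11.
have d0 : 0 < t2 - t1 by rewrite subr_gt0 lt_neqAle ne (le_trans t1t).
pose l := (t - t1) / (t2 - t1).
have l0 : 0 <= l by apply: divr_ge0; [rewrite subr_ge0|exact: ltW].
have l1 : l <= 1 by rewrite ler_pdivrMr// mul1r lerD2r.
have tE : t = (1 - l) * t1 + l * t2.
  by rewrite /l; field; rewrite gt_eqF.
exists ((1 - l) * r1 + l * r2) => /=.
  by rewrite in_itv/=; nra.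
have -> : x + t *: y = (1 - l) *: (x + t1 *: y) + l *: (x + t2 *: y).
  by rewrite tE; apply/rowP => i; rewrite !mxE; ring.
by rewrite -e1 -e2; apply/rowP => i; rewrite !mxE; ring.
Qed.

(** Over the gap the curve either keeps to an edge or avoids the boundary altogether. In the latter
    case its image is connected, hence within one component of the complement. *)
Lemma region_gap (P : polygon R) (g : R -> 'rV[R]_2) (a b : R) : continuous g ->
  (forall i t t', a < t < b -> a < t' < b ->
     edge (p := P) i (g t) -> edge (p := P) i (g t')) ->
  forall t t', a < t < b -> a < t' < b -> region P (g t) -> region P (g t').
Proof.
move=> cg gap t t' tab t'ab [[i _ it]|[nb bnd]].
  by left; exists i => //; exact: gap it.
have nbd r : a < r < b -> ~ boundary P (g r).
  by move=> rab [i _ ir]; apply: nb; exists i => //; exact: gap ir.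
right; split; first exact: nbd.
suff -> : connected_component (~` boundary P) (g t') =
          connected_component (~` boundary P) (g t) by [].
apply/esym/same_connected_component.
apply: (@connected_component_max _ _ (g @` `]a, b[)).
- by exists t; rewrite //= in_itv.
- by move=> _ [r + <-]; rewrite /= in_itv/= => /nbd.
- apply: connected_continuous_connected; last exact: continuous_subspaceT.
  exact/connected_intervalP/interval_is_interval.
- by exists t'; rewrite //= in_itv.
Qed.

(** The straight segment is cut wherever it enters or leaves an edge. Membership in each polygon is
    then constant on every open piece, and the midpoint decides the zone. *)
Lemma wdist_lty k (P : 'I_k -> polygon R) (omega : 'I_k -> R) x y :
  (forall j, 0 < omega j) -> (wdist P omega x y < +oo)%E.
Proof.
move=> omega_gt0.
pose g (t : R) : 'rV[R]_2 := x + t *: (y - x).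
have cg : continuous g by exact: continuous_line.
pose E := {j : 'I_k & 'I_(nvert (P j))}.
pose I (e : E) := [set t | edge (p := P (tag e)) (tagged e) (g t)].
(* For an empty or unbounded [I e] the default values of [inf] and [sup] are harmless extra cut
   candidates. *)
pose B := [seq inf (I e) | e : E] ++ [seq sup (I e) | e : E].
have [s [s01 gap]] := gap_partition B.
have stay j (i : 'I_(size s)) : forall t t',
    nth 1 (0 :: s) i < t < nth 1 (0 :: s) i.+1 ->
    nth 1 (0 :: s) i < t' < nth 1 (0 :: s) i.+1 ->
    region (P j) (g t) -> region (P j) (g t').
  apply: region_gap => // v t t' ht ht'.
  apply: (@interval_gap (I (Tagged (fun j => 'I_(nvert (P j))) v)) _ _ _ _ _ t t' ht ht').
  - exact: segment_interval.
  - apply: gap => //; rewrite mem_cat; apply/orP; left.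
    by apply/mapP; exists (Tagged (fun j => 'I_(nvert (P j))) v); rewrite ?mem_enum.
  - apply: gap => //; rewrite mem_cat; apply/orP; right.
    by apply/mapP; exists (Tagged (fun j => 'I_(nvert (P j))) v); rewrite ?mem_enum.
pose mid (i : 'I_(size s)) : R := (nth 1 (0 :: s) i + nth 1 (0 :: s) i.+1) / 2.
have lts (i : 'I_(size s)) : nth 1 (0 :: s) i < nth 1 (0 :: s) i.+1.
  by have [/(pathP 1) H _] := s01; exact: H.
have midP (i : 'I_(size s)) : nth 1 (0 :: s) i < mid i < nth 1 (0 :: s) i.+1.
  by have := lts i; rewrite /mid => ?; apply/andP; split; lra.
pose c (i : 'I_(size s)) := [pick j | `[< region (P j) (g (mid i)) >]].
have dc : decomposition P g c.
  split=> // i _ [t + <-]; rewrite /= in_itv/= => ti; rewrite /c.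
  case: pickP => [j /asboolP /= rj|/= nr]; first exact: (stay j i _ t (midP i) ti rj).
  by move=> [j _ rj]; have /asboolP := nr j; apply; exact: (stay j i t _ ti (midP i) rj).
apply: (@le_lt_trans _ _ (weighted_length omega g c)).
  apply: ereal_inf_lbound; exists g, s, c; split=> //; split.
  - exact: continuous_subspaceT.
  - by rewrite /g scale0r addr0.
  - by rewrite /g scale1r addrC subrK.
apply: lte_sum_pinfty => i _; apply: lte_mul_pinfty => //.
  by rewrite lee_fin ltW// zone_weight_gt0.
exact: curve_length_line.
Qed.

End segment_path.

(** * Minimizers lie in the convex hull *)

Theorem theorem4p14 (R : realType) (k N : nat) (P : 'I_k -> polygon R)
  (D : set 'rV[R]_2) (omega : 'I_k -> R) (p : 'I_N -> 'rV[R]_2)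
  (hN : (0 < N)%N)
  (hP : partitions_region P D)
  (homega : forall j, 0 < omega j)
  (q : 'rV[R]_2)
  (hq : forall q', (sum_wdist P omega p q <= sum_wdist P omega p q')%E) :
  convex_hull (range p `|` \bigcup_j region (P j)) q.
Proof.
apply: contrapT => nq.
(* The points [p i] and all the vertices form one finite family; [hN] makes it nonempty, as the
   separation requires. *)
pose E : finType := ('I_N + {j : 'I_k & 'I_(nvert (P j))})%type.
pose F (e : E) : 'rV[R]_2 := match e with inl i => p i
  | inr v => vertex (p := P (tag v)) (tagged v) end.
have [n En] : exists n, #|E| = n.+1.
  by exists #|E|.-1; rewrite prednK// card_sum card_ord addn_gt0 hN.
pose F' i := F (enum_val (cast_ord (esym En) i)).
have [|u [d [u1 d0 Fd]]] := @finite_strict_separation R n F' q.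
  (* The hull of this family lies in the full hull: each vertex belongs to its polygon, as parameter
     0 of its edge. *)
  move=> qF; apply: nq => A [cA hA]; apply: qF; split=> // _ [i _ <-].
  rewrite /F'; case: (enum_val _) => [j|v] /=; first by apply: hA; left; exists j.
  apply: hA; right; exists (tag v) => //; left; exists (tagged v) => //.
  exists 0; first by rewrite /= in_itv/= lexx ler01.
  by rewrite subr0 scale1r scale0r addr0.
pose m := dot u q - d.
have Fm e : dot u (F e) <= m.
  by have := Fd (cast_ord En (enum_rank e)); rewrite /F' cast_ordK enum_rankK.
have Pm j x : region (P j) x -> dot u x <= m.
  apply: region_halfplane => [|i]; first by rewrite u1 oner_eq0.
  exact: (Fm (inr (Tagged (fun j => 'I_(nvert (P j))) i))).
(* Halfway between [m] and [dot u q], so that [m < m'] strictly while [q] still overshoots by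
   [d / 2]. *)
pose m' := dot u q - d / 2.
have mm' : m < m' by rewrite /m /m'; lra.
have ov : overshoot u m' q = d / 2 by rewrite overshoot_gt /m'; lra.
pose w x := \sum_(i < N) fine (wdist P omega (p i) x).
have wfin x y : wdist P omega x y \is a fin_num.
  by rewrite ge0_fin_numE ?wdist_lty ?wdist_ge0.
have wE x : sum_wdist P omega p x = (w x)%:E.
  by rewrite -sumEFin; apply: eq_bigr => i _; rewrite fineK.
have w0 : 0 <= w q by apply: sumr_ge0 => i _; rewrite fine_ge0 ?wdist_ge0.
have wmin : w q <= w (truncate u m' q) by rewrite -lee_fin -!wE.
have ineq a b : a ^+ 2 + b ^+ 2 = 1 -> 0 < a -> 0 < b ->
    a * w (truncate u m' q) + b * (d / 2) <= w q.
  move=> ab a0 b0.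
  have H i : a * fine (wdist P omega (p i) (truncate u m' q)) + b * (d / 2) <=
      fine (wdist P omega (p i) q).
    rewrite -lee_fin EFinD EFinM !fineK// -ov.
    apply: (wdist_truncate P omega homega u m m' u1 mm' Pm _ _ _ _ ab a0).
    by rewrite (le_trans (Fm (inl i)))// ltW.
  (* Summation gives [N] copies of [b * (d / 2)]; one suffices, as [N] is positive and the term
     nonnegative. *)
  rewrite /w mulr_sumr; apply: (@le_trans _ _ (\sum_(i < N)
    (a * fine (wdist P omega (p i) (truncate u m' q)) + b * (d / 2)))); last first.
    by apply: ler_sum => i _; exact: H.
  rewrite big_split/= lerD2l sumr_const card_ord -[leRHS]mulr_natl ler_peMl//; last first.
    by rewrite ler1n.
  by apply: mulr_ge0; [exact: ltW|apply: divr_ge0; [exact: ltW|]].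
(* Rational parametrisation of the circle, [a = (1 - t^2) / (1 + t^2)] and [b = 2t / (1 + t^2)].
   Clearing the denominator leaves [t * d <= 2 * t^2 * w q]. *)
have {ineq} small t : 0 < t -> t < 1 -> d <= 2 * t * w q.
  move=> t0 t1; have t2 : 0 < 1 + t ^+ 2 by rewrite ltr_wpDr ?sqr_ge0.
  set D' := 1 + t ^+ 2 in t2.
  have D'0 : D' != 0 by rewrite gt_eqF.
  have ab : ((1 - t ^+ 2) / D') ^+ 2 + (2 * t / D') ^+ 2 = 1 by rewrite /D'; field.
  have a0 : 0 < (1 - t ^+ 2) / D' by rewrite divr_gt0// subr_gt0 expr_lt1// ltW.
  have b0 : 0 < 2 * t / D' by rewrite divr_gt0// mulr_gt0.
  have H := ineq _ _ ab a0 b0.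
  have {}H : (1 - t ^+ 2) / D' * w q + 2 * t / D' * (d / 2) <= w q.
    by apply: le_trans H; rewrite lerD2r ler_wpM2l// ltW.
  have : ((1 - t ^+ 2) / D' * w q + 2 * t / D' * (d / 2)) * D' <= w q * D'.
    by rewrite ler_pM2r.
  have -> : ((1 - t ^+ 2) / D' * w q + 2 * t / D' * (d / 2)) * D' =
      (1 - t ^+ 2) * w q + t * d by field.
  by move=> Hd; rewrite -(ler_pM2l t0); move: Hd; rewrite /D'; nra.
have e0 : 0 < 4 * w q + 2 * d by lra.
(* With this [t], [2 * t * w q] is less than [d] because [2 * w q < 4 * w q + 2 * d]: a
   contradiction. *)
have := small (d / (4 * w q + 2 * d)).
rewrite divr_gt0// ltr_pdivrMr// => /(_ isT) H.
have {}H : d <= 2 * (d / (4 * w q + 2 * d)) * w q by apply: H; lra.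
have : d * (4 * w q + 2 * d) <= 2 * d * w q.
  rewrite -ler_pdivlMr//; apply: le_trans H _; rewrite le_eqVlt; apply/orP; left.
  by apply/eqP; field; rewrite gt_eqF.
nra.
Qed.
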